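(* Let $l,r$ be positive integers and let $R=\{-l,r\}$. Then for any alphabet size $q\ge 2$, $$\mathsf{cap}(\mathbb Z_R)=\frac{\gcd(l,r)}{l+r}.$$
   Context: Let $Q$ be a finite alphabet of size $q\ge 2$. For a finite set $R\subset\mathbb Z\setminus\{0\}$, an $R$-recoverable system on $\mathbb Z$ is a nonempty set $X\subseteq Q^{\mathbb Z}$ such that for every $i\in\mathbb Z$ there is a function $f_i:Q^{|R|}\to Q$ (which may depend on $i$) with $x_i=f_i(x_{i+R})$ for all $x\in X$, where $x_{i+R}$ is the restriction of $x$ to $i+R=\{i+j:j\in R\}$. Its rate is $\mathcal R(X)=\limsup_{n\to\infty}\frac1n\log_q|B_n(X)|$, where $B_n(X)=\{x_{[n]}:x\in X\}$ and $[n]=\{0,1,\dots,n-1\}$. The capacity $\mathsf{cap}(\mathbb Z_R)$ is the supremum of $\mathcal R(X)$ over all $R$-recoverable systems $X\subseteq Q^{\mathbb Z}$. *)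

(* Defs.v *)
From mathcomp Require Import all_boot all_order all_algebra finmap.
From mathcomp Require Import all_classical all_reals all_analysis.

Set Implicit Arguments.
Unset Strict Implicit.
Unset Printing Implicit Defensive.

Import Order.TTheory GRing.Theory Num.Theory.
Local Open Scope ring_scope.
Local Open Scope classical_set_scope.

(* The restriction x_{i+R}, indexed by the elements of R: entry j is x_{i+j}. *)
Definition window (Q : finType) (R : {fset int}) (x : int -> Q) (i : int) :
  {ffun R -> Q} := [ffun j : R => x (i + val j)].

Definition recoverable (Q : finType) (R : {fset int}) (X : set (int -> Q)) :
  Prop :=
  [/\ 0 \notin R, X !=set0 &
      forall i : int, exists f : {ffun R -> Q} -> Q,
        forall x, X x -> x i = f (window R x i)].

Definition blocks (Q : finType) (n : nat) (X : set (int -> Q)) :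
  {set {ffun 'I_n -> Q}} :=
  [set w | `[< exists2 x, X x & w = [ffun k : 'I_n => x k%:Z] >]]%SET.

Definition log_base (K : realType) (b x : K) : K := ln x / ln b.

(* The term of index 0 is 0, as 0^-1 = 0; it does not affect the limsup. *)
Definition rate (K : realType) (Q : finType) (X : set (int -> Q)) : \bar K :=
  limn_esup (fun n : nat =>
    (n%:R^-1 * log_base #|Q|%:R #|blocks n X|%:R)%:E).

Definition capacity (K : realType) (Q : finType) (R : {fset int}) : \bar K :=
  ereal_sup [set rate K X | X in [set X : set (int -> Q) | recoverable R X]].

(* Main.v *)
(* Put [m = l + r] and [g = gcd l r].  The graph with arrows from [i] to
   [i - l] and [i + r] moves by [r] modulo [m], so a path of bounded length
   from any site meets a site [j] with [j mod m < g] or leaves the block.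
   These sites, of density [g / m], together with the [l] leftmost and [r]
   rightmost ones, thus determine a block of a recoverable system.
   Conversely, cut Z into cells of length [m]: for every [i], one of [i - l]
   and [i + r] lies in the cell of [i], so the configurations that in each
   cell depend only on [i mod g] form a recoverable system, of rate [g / m]. *)
Require Import Defs.
From mathcomp Require Import all_boot all_order all_algebra finmap.
From mathcomp Require Import all_classical all_reals all_analysis.
From mathcomp Require Import zify.

Set Implicit Arguments.
Unset Strict Implicit.
Unset Printing Implicit Defensive.

Import Order.TTheory GRing.Theory Num.Theory.
Local Open Scope ring_scope.
Local Open Scope classical_set_scope.

(** * Upper bound on the number of blocks *)

Lemma exists_mod_lt_gcd (l r i : nat) : (0 < l)%N ->
  exists k, ((i + k * r) %% (l + r) < gcdn l r)%N.
Proof.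
move=> l_gt0; have m_gt0 : (0 < l + r)%N by rewrite addn_gt0 l_gt0.
set g := gcdn l r; have g_gt0 : (0 < g)%N by rewrite gcdn_gt0 l_gt0.
have g_le : (g <= l + r)%N.
  by apply: leq_trans (leq_addr _ _); rewrite dvdn_leq ?dvdn_gcdl.
have [a _ dvd_a] := Bezoutl r m_gt0.
have {}dvd_a : (l + r %| g + a * r)%N.
  by move: dvd_a; rewrite [gcdn (l + r) r]gcdnC gcdnDr gcdnC.
(* Bezout gives [a * r] congruent to [- g] modulo [l + r], so [a] steps of length [r] lower the
   residue by [g]. Repeating this [i %/ g] times leaves [i %% g]. *)
exists (i %/ g * a)%N.
have -> : (i + i %/ g * a * r = i %/ g * (g + a * r) + i %% g)%N.
  by rewrite {1}(divn_eq i g) mulnDr mulnA addnAC.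
rewrite -modnDml; move/(dvdn_mull (i %/ g)): dvd_a => /eqP ->.
by rewrite add0n modn_small ?(leq_trans (ltn_pmod _ _)) ?ltn_pmod.
Qed.

Lemma recoverable_eq (Q : finType) (l r : nat) (X : set (int -> Q))
    (x y : int -> Q) (i : int) :
  recoverable [fset - l%:Z; r%:Z]%fset X -> X x -> X y ->
  x (i - l%:Z) = y (i - l%:Z) -> x (i + r%:Z) = y (i + r%:Z) -> x i = y i.
Proof.
move=> [_ _ /(_ i)[f fP]] Xx Xy eql eqr; rewrite (fP x) // (fP y) //.
congr f; apply/ffunP => j; rewrite !ffunE.
by have := valP j; rewrite !inE => /orP[] /eqP ->.
Qed.

(* Modulo [l + r] both neighbours [i - l] and [i + r] are equal, so an
   induction on the number of steps follows all paths at once. *)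
Lemma recoverable_determined (Q : finType) (l r n : nat) (X : set (int -> Q))
    (x y : int -> Q) : (0 < l)%N ->
  recoverable [fset - l%:Z; r%:Z]%fset X -> X x -> X y ->
  (forall i : nat, (i < n)%N ->
     [|| i %% (l + r) < gcdn l r, i < l | n <= i + r]%N -> x i%:Z = y i%:Z) ->
  forall i : nat, (i < n)%N -> x i%:Z = y i%:Z.
Proof.
move=> l_gt0 recX Xx Xy eq_xy i i_lt.
have [k] := exists_mod_lt_gcd r i l_gt0.
elim: k i i_lt => [|k IHk] i i_lt hk.
  by apply: eq_xy => //; rewrite mul0n addn0 in hk; rewrite hk.
have [i_bd|] := boolP ((i < l) || (n <= i + r))%N.
  by apply: eq_xy => //; rewrite i_bd orbT.
rewrite negb_or -leqNgt -ltnNge => /andP[le_li lt_irn].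
apply: (recoverable_eq recX Xx Xy).
- rewrite subzn //; apply: IHk; first exact: leq_ltn_trans (leq_subr _ _) i_lt.
  have e : (i + k.+1 * r = i - l + k * r + (l + r))%N by rewrite mulSn; lia.
  by rewrite e modnDr in hk.
- rewrite -PoszD; apply: IHk => //.
  by rewrite mulSn addnA in hk.
Qed.

Lemma card_blocks_le (Q : finType) (l r n : nat) (X : set (int -> Q)) :
  (0 < l)%N -> recoverable [fset - l%:Z; r%:Z]%fset X ->
  (#|blocks n X| <= #|Q| ^ (gcdn l r * (n %/ (l + r)).+1 + l + r))%N.
Proof.
move=> l_gt0 recX; have [_ [x0 Xx0] _] := recX.
set m := (l + r)%N; set g := gcdn l r.
have m_gt0 : (0 < m)%N by rewrite addn_gt0 l_gt0.
pose I := ('I_(n %/ m).+1 * 'I_g + 'I_l + 'I_r)%type.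
(* [s] extends each block to a configuration of [X]; [x0] is a default for words that are not
   blocks. Whole configurations are needed because some sites [pos p] may lie outside the block:
   past its end in the last, incomplete cell, or at negative sites when [n < r]. *)
have /choice[s sP] (w : {ffun 'I_n -> Q}) : exists x, w \in blocks n X ->
    X x /\ w = [ffun k : 'I_n => x k%:Z].
  have [|_] := boolP (w \in _); last by exists x0.
  by rewrite inE => /asboolP[x Xx ->]; exists x.
pose pos (p : I) : int := match p with
  | inl (inl p) => (p.1 * m + p.2)%:Z | inl (inr a) => a%:Z
  | inr b => n%:Z - r%:Z + b%:Z end.
have -> : (#|Q| ^ (g * (n %/ m).+1 + l + r) = #|{ffun I -> Q}|)%N.
  by rewrite card_ffun !card_sum card_prod !card_ord mulnC.
apply: (@leq_card_in _ _ (fun w => [ffun p => s w (pos p)])) => w w' wB wB' eq_ww'.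
have [[Xw ew] [Xw' ew']] := (sP _ wB, sP _ wB').
rewrite ew ew'; apply/ffunP => k; rewrite !ffunE.
have eq_pos p : s w (pos p) = s w' (pos p).
  by move/ffunP/(_ p): eq_ww'; rewrite !ffunE.
apply: (recoverable_determined l_gt0 recX Xw Xw' _ (ltn_ord k)) => i i_lt.
case/or3P => hi.
- have hq : (i %/ m < (n %/ m).+1)%N by rewrite ltnS leq_div2r // ltnW.
  have := eq_pos (inl (inl (Ordinal hq, Ordinal hi))).
  by rewrite /= -divn_eq.
- exact: eq_pos (inl (inr (Ordinal hi))).
- have hb : (i + r - n < r)%N by lia.
  have := eq_pos (inr (Ordinal hb)); rewrite /=.
  by have -> : n%:Z - r%:Z + (i + r - n)%N%:Z = i%:Z by lia.
Qed.

(** * A recoverable system with many blocks *)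

Definition cellwise_constant (Q : finType) (m g : nat) : set (int -> Q) :=
  [set x | forall i j : int,
     (i %/ m = j %/ m)%Z -> (i = j %[mod g])%Z -> x i = x j].

Arguments cellwise_constant : clear implicits.

(** Let [s] be the offset of [i] in its cell. If [l <= s], then [s - l] is still an offset in the
    cell; otherwise [s + r < l + r]. *)
Lemma divz_sub_or_add (l r : nat) (i : int) : (0 < l)%N ->
  ((i - l%:Z) %/ (l + r)%N)%Z = (i %/ (l + r)%N)%Z \/
  ((i + r%:Z) %/ (l + r)%N)%Z = (i %/ (l + r)%N)%Z.
Proof.
move=> l_gt0; set m : int := (l + r)%N.
have m_gt0 : 0 < m by rewrite /m; lia.
have m_neq0 : m != 0 by rewrite gt_eqF.
have s_ge0 := modz_ge0 i m_neq0; have s_lt := ltz_pmod i m_gt0.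
have em : m = l%:Z + r%:Z by [].
move: (i %/ m)%Z (i %% m)%Z (divz_eq i m) s_ge0 s_lt => q s -> s_ge0 s_lt.
rewrite -!addrA !divzMDl //.
have [le_ls|lt_sl] := leP l%:Z s; [left|right];
  rewrite divz_small ?addr0 //; lia.
Qed.

(** Since the gcd divides [l] and [r], both neighbours have the residue of [i]. The recovery
    function copies the one in the same cell; which one that is depends on [i] alone, not on the
    configuration. *)
Lemma recoverable_cellwise_constant (Q : finType) (l r : nat) :
  (0 < l)%N -> (0 < r)%N -> (0 < #|Q|)%N ->
  recoverable [fset - l%:Z; r%:Z]%fset
    (cellwise_constant Q (l + r) (gcdn l r)).
Proof.
move=> l_gt0 r_gt0 /card_gt0P[q0 _]; split.
- by rewrite !inE negb_or; apply/andP; split; apply/eqP; lia.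
- by exists (fun=> q0).
- move=> i.
  have hl : - l%:Z \in [fset - l%:Z; r%:Z]%fset by rewrite !inE eqxx.
  have hr : r%:Z \in [fset - l%:Z; r%:Z]%fset by rewrite !inE eqxx orbT.
  have [e|e] := divz_sub_or_add r i l_gt0.
  + exists (fun w => w [` hl]%fset) => x xX; rewrite ffunE /=.
    apply: xX => //; apply/eqP; rewrite eqz_mod_dvd opprB addrC subrK.
    exact: dvdn_gcdl.
  + exists (fun w => w [` hr]%fset) => x xX; rewrite ffunE /=.
    apply: xX => //; apply/eqP; rewrite eqz_mod_dvd opprD addrA subrr add0r.
    by rewrite dvdzE abszN dvdn_gcdr.
Qed.

Lemma card_blocks_cellwise_constant (Q : finType) (m g n : nat) :
  (0 < #|Q|)%N -> (0 < g)%N -> (0 < m)%N -> (g %| m)%N ->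
  (#|Q| ^ (g * (n %/ m)) <= #|blocks n (cellwise_constant Q m g)|)%N.
Proof.
move=> /card_gt0P[q0 _] g_gt0 m_gt0 dvd_gm.
pose I := ('I_(n %/ m) * 'I_g)%type.
pose cell (i : int) (p : I) := ((i %/ m)%Z == p.1%:Z) && ((i %% g)%Z == p.2%:Z).
(* Only the [n %/ m] cells lying entirely in the block are filled freely, each with [g] values
   repeated periodically; every other cell is constantly [q0]. *)
pose ext (c : {ffun I -> Q}) (i : int) := oapp c q0 [pick p | cell i p].
have extP c (a : 'I_(n %/ m)) (b : 'I_g) : ext c (a * m + b)%N%:Z = c (a, b).
  have b_lt : (b < m)%N by apply: leq_trans (ltn_ord b) (dvdn_leq _ _).
  have eD : ((a * m + b)%N%:Z %/ m)%Z = a by rewrite divz_nat divnMDl // (divn_small b_lt) addn0.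
  have eM : ((a * m + b)%N%:Z %% g)%Z = b.
    rewrite modz_nat -modnDml; move/(dvdn_mull a): dvd_gm => /eqP ->.
    by rewrite add0n modn_small.
  rewrite /ext /cell eD eM; case: pickP => [[a' b'] /= /andP[]|/(_ (a, b))].
    by move=> /eqP[/val_inj ->] /eqP[/val_inj ->].
  by rewrite /= !eqxx.
have -> : (#|Q| ^ (g * (n %/ m)) = #|{ffun I -> Q}|)%N.
  by rewrite card_ffun card_prod !card_ord mulnC.
pose F c := [ffun k : 'I_n => ext c k%:Z].
have F_inj : injective F.
  move=> c c' /ffunP eqF; apply/ffunP => -[a b]; rewrite -!extP.
  have lt_n : (a * m + b < n)%N.
    have b_lt : (b < m)%N by apply: leq_trans (ltn_ord b) (dvdn_leq _ _).
    apply: (@leq_trans (a.+1 * m)); first by rewrite mulSn addnC ltn_add2r.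
    by rewrite (leq_trans _ (leq_divM n m)) // leq_mul2r ltn_ord orbT.
  by have := eqF (Ordinal lt_n); rewrite !ffunE.
rewrite -(card_codom F_inj); apply: subset_leq_card; apply/fintype.subsetP => _ /codomP[c ->].
(* [ext c] reads [i] only through its cell and its residue modulo [g]. *)
rewrite inE; apply/asboolP; exists (ext c) => // i j eD eM.
by rewrite /ext /cell eD eM.
Qed.

(** * Limits superior up to an error of order [1 / n] *)

Section Limsup.
Variable K : realType.
Implicit Types (u : nat -> K) (a c : K).

Lemma eventually_div_lt c (e : K) : 0 < e ->
  exists N, (0 < N)%N /\ forall n, (N <= n)%N -> c / n%:R < e.
Proof.
move=> e_gt0; exists (Num.truncn `|c / e|).+1; split=> // n le_n.
have n_gt0 : 0 < n%:R :> K by rewrite ltr0n; apply: leq_trans le_n.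
rewrite ltr_pdivrMr // mulrC -ltr_pdivrMr //.
apply: le_lt_trans (ler_norm _) _; apply: lt_le_trans (truncnS_gt _) _.
by rewrite ler_nat.
Qed.

Lemma limn_esup_le_div u a c :
  (forall n, (0 < n)%N -> u n <= a + c / n%:R) ->
  (limn_esup (fun n => (u n)%:E) <= a%:E)%E.
Proof.
move=> u_le; apply/lee_addgt0Pr => e e_gt0.
have [N [N_gt0 NP]] := eventually_div_lt c e_gt0.
rewrite /limn_esup limf_esupE.
apply: (@le_trans _ _ (ereal_sup ((fun n => (u n)%:E) @` [set n | (N <= n)%N]))).
  by apply: ereal_inf_lbound; exists [set n | (N <= n)%N] => //; exact: nbhs_infty_ge.
apply: ge_ereal_sup => _ [n /= le_n <-]; rewrite -EFinD lee_fin.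
apply: le_trans (u_le n _) _; first exact: leq_trans le_n.
by rewrite lerD2l ltW // NP.
Qed.

Lemma limn_esup_ge_div u a c :
  (forall n, (0 < n)%N -> a - c / n%:R <= u n) ->
  (a%:E <= limn_esup (fun n => (u n)%:E))%E.
Proof.
move=> u_ge; rewrite /limn_esup limf_esupE.
apply: le_ereal_inf_tmp => _ [V [M _ MV] <-].
apply/lee_addgt0Pr => e e_gt0.
have [N [N_gt0 NP]] := eventually_div_lt c e_gt0.
(* [V] contains the tail from [M] on, so it has an index with error below [e]; this single term
   bounds the supremum over [V] from below. *)
pose n := maxn M N.
apply: (@le_trans _ _ ((u n)%:E + e%:E)%E); last first.
  rewrite leeD2r //; apply: ereal_sup_ubound; exists n => //.
  by apply: MV; rewrite /= leq_maxl.
rewrite -EFinD lee_fin -lerBlDr; apply: le_trans (u_ge n _).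
  by rewrite lerD2l lerN2 ltW // NP // leq_maxr.
by apply: leq_trans (leq_maxr _ _).
Qed.

End Limsup.

(** * From block counts to rates *)

Lemma log_base_le (K : realType) (q N e : nat) : (1 < q)%N -> (0 < N)%N ->
  (N <= q ^ e)%N -> log_base q%:R N%:R <= e%:R :> K.
Proof.
move=> q_gt1 N_gt0 le_N; rewrite ler_pdivrMr ?ln_gt0 ?ltr1n //.
rewrite mulr_natl -lnXn ?ltr0n; last exact: ltnW.
by rewrite -natrX ler_ln ?posrE ?ltr0n ?ler_nat // expn_gt0 ltnW.
Qed.

Lemma log_base_ge (K : realType) (q N e : nat) : (1 < q)%N ->
  (q ^ e <= N)%N -> e%:R <= log_base q%:R N%:R :> K.
Proof.
move=> q_gt1 le_N; have qe_gt0 : (0 < q ^ e)%N by rewrite expn_gt0 ltnW.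
rewrite ler_pdivlMr ?ln_gt0 ?ltr1n //.
rewrite mulr_natl -lnXn ?ltr0n; last exact: ltnW.
by rewrite -natrX ler_ln ?posrE ?ltr0n ?ler_nat // (leq_trans qe_gt0).
Qed.

Lemma rate_le (K : realType) (Q : finType) (X : set (int -> Q)) (m g c : nat) :
  (1 < #|Q|)%N -> (0 < m)%N -> X !=set0 ->
  (forall n, (#|blocks n X| <= #|Q| ^ (g * (n %/ m) + c))%N) ->
  (rate K X <= (g%:R / m%:R)%:E)%E.
Proof.
move=> q_gt1 m_gt0 [x0 Xx0] blocks_le.
apply: (@limn_esup_le_div _ _ _ c%:R) => n n_gt0.
have n_gt0' : 0 < n%:R :> K by rewrite ltr0n.
have m_gt0' : 0 < m%:R :> K by rewrite ltr0n.
have B_gt0 : (0 < #|blocks n X|)%N.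
  apply/card_gt0P; exists [ffun k : 'I_n => x0 k%:Z].
  by rewrite inE; apply/asboolP; exists x0.
rewrite ler_pdivrMl // mulrDr [X in _ <= _ + X]mulrC divfK ?gt_eqF //.
apply: le_trans (log_base_le K q_gt1 B_gt0 (blocks_le n)) _.
rewrite natrD lerD2r mulrCA natrM ler_wpM2l ?ler0n // ler_pdivlMr //.
by rewrite -natrM ler_nat leq_divM.
Qed.

Lemma rate_ge (K : realType) (Q : finType) (X : set (int -> Q)) (m g : nat) :
  (1 < #|Q|)%N -> (0 < m)%N ->
  (forall n, (#|Q| ^ (g * (n %/ m)) <= #|blocks n X|)%N) ->
  ((g%:R / m%:R)%:E <= rate K X)%E.
Proof.
move=> q_gt1 m_gt0 blocks_ge.
apply: (@limn_esup_ge_div _ _ _ g%:R) => n n_gt0.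
have n_gt0' : 0 < n%:R :> K by rewrite ltr0n.
(* The error constant is [g] because rounding [n / m] down loses at most 1 in the factor multiplied
   by [g]. *)
have m_gt0' : 0 < m%:R :> K by rewrite ltr0n.
rewrite ler_pdivlMl // mulrBr [X in _ - X]mulrC divfK ?gt_eqF //.
apply: le_trans (log_base_ge K q_gt1 (blocks_ge n)).
rewrite lerBlDr mulrCA natrM -[X in _ <= _ + X]mulr1 -mulrDr.
rewrite ler_wpM2l ?ler0n // ler_pdivrMr // natr1 -natrM ler_nat.
by rewrite ltnW // ltn_ceil.
Qed.

Theorem proposition4p3 (K : realType) (Q : finType) (l r : nat)
    (hl : (0 < l)%N) (hr : (0 < r)%N) (hq : (2 <= #|Q|)%N) :
  capacity K Q [fset - l%:Z; r%:Z]%fset = ((gcdn l r)%:R / (l + r)%:R)%:E.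
Proof.
have m_gt0 : (0 < l + r)%N by rewrite addn_gt0 hl.
apply/eqP; rewrite eq_le; apply/andP; split.
  apply: ge_ereal_sup => _ [X recX <-]; have [_ X0 _] := recX.
  (* The bounded excess consists of the gcd, from the incomplete last cell, and of the [l + r]
     border sites. *)
  apply: (@rate_le _ _ _ _ _ (gcdn l r + l + r)) => // n.
  apply: leq_trans (card_blocks_le n hl recX) _.
  by rewrite mulnS [(gcdn l r + _)%N]addnC !addnA.
apply: le_trans (_ : rate K (cellwise_constant Q (l + r) (gcdn l r)) <= _)%E.
  apply: rate_ge => // n; apply: card_blocks_cellwise_constant => //.
  - exact: ltnW.
  - by rewrite gcdn_gt0 hl.
  - by rewrite dvdn_add ?dvdn_gcdl ?dvdn_gcdr.
apply: ereal_sup_ubound; exists (cellwise_constant Q (l + r) (gcdn l r)) => //.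
by apply: recoverable_cellwise_constant => //; exact: ltnW.
Qed.
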